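(* For every complex number $q$ with $|q|<1$, $$\frac{1+q^3}{(1-q)(1-q^2)}+\sum_{n=1}^\infty \frac{q^{n(n+2)}(-q;q)_{n-1}(-q;q)_{n+2}}{(q;q)_{2n+2}} = \frac{f(q^3,q^9)}{f(-q)} = \frac{(-q^3,-q^9,q^{12};q^{12})_\infty}{(q;q)_\infty}.$$
   Context: Notation: $(a;q)_n=\prod_{j=0}^{n-1}(1-aq^j)$ (so $(a;q)_0=1$), $(a;q)_\infty=\prod_{j=0}^\infty(1-aq^j)$, and $(a_1,\dots,a_r;q)_\infty=(a_1;q)_\infty\cdots(a_r;q)_\infty$; the base may be replaced by a power of $q$. Ramanujan's (two-variable) theta function is $f(a,b)=\sum_{n=-\infty}^\infty a^{n(n+1)/2}b^{n(n-1)/2}$ for $|ab|<1$ (with $0^0=1$). The one-variable abbreviation is $f(-q)=f(-q,-q^2)$. *)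

(* Defs.v *)
From Stdlib Require Import Reals ZArith List.
From Coquelicot Require Import Coquelicot.
Import ListNotations.
Open Scope C_scope.

(* As with [RInt], the limit operators below are total ([iota]) and meaningful
   only when the limit exists. *)

Definition CSeries (a : nat -> C) : C :=
  iota (T := C_CompleteNormedModule)
    (fun l : C => is_series (K := C_AbsRing) (V := C_NormedModule) a l).

(* (a; q)_n *)
Fixpoint qpoch (a q : C) (n : nat) : C :=
  match n with
  | O => 1
  | S m => qpoch a q m * (1 - a * q ^ m)
  end.

(* (a; q)_oo *)
Definition qpoch_inf (a q : C) : C :=
  iota (T := C_CompleteNormedModule)
    (fun l : C => filterlim (qpoch a q) eventually (locally (T := C_UniformSpace) l)).

(* (a_1, ..., a_r; q)_oo *)
Definition qpoch_inf_list (s : list C) (q : C) : C :=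
  fold_right (fun a p => qpoch_inf a q * p) 1 s.

(* Both exponents are nonnegative integers for every n in Z, and [Cpow]
   satisfies 0 ^ 0 = 1. *)
Definition theta_term (a b : C) (n : Z) : C :=
  a ^ Z.to_nat (n * (n + 1) / 2) * b ^ Z.to_nat (n * (n - 1) / 2).

(* Ramanujan's f(a, b): the sum over n in Z is split into n >= 0 and n <= -1. *)
Definition theta (a b : C) : C :=
  CSeries (fun n : nat => theta_term a b (Z.of_nat n))
  + CSeries (fun n : nat => theta_term a b (- Z.of_nat (S n))).

(* [theta_neg q] is f(-q) = f(-q, -q^2): the argument is q, not -q. *)
Definition theta_neg (q : C) : C := theta (- q) (- q ^ 2).

(* Main.v *)
Require Import Defs.
From Stdlib Require Import Reals ZArith List Lra Lia.
From Coquelicot Require Import Coquelicot.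
Import ListNotations.
Open Scope C_scope.

(** The series is half of a sum of Bailey type. Put c_r = a^(r(r+1)/2) b^(r(r-1)/2)
    and q = ab. The finite form of Jacobi's triple product
    ([symmetric_triple_product]) reads

      (-a; q)_n (-b; q)_n / (q; q)_(2n)
        = sum over |r| <= n of c_r / ((q; q)_(n-r) (q; q)_(n+r)).

    Multiply by q^(n^2) and sum over n. The inner sum over n is a Durfee rectangle
    sum, equal to q^(r^2) / (q; q)_oo ([durfee_sum]), and c_r q^(r^2) is the general
    term of f(aq, bq). Hence ([bailey_theta_sum])

      sum_n q^(n^2) (-a; q)_n (-b; q)_n / (q; q)_(2n) = f(aq, bq) / (q; q)_oo.

    For a = -1, b = -q only the term n = 0 is nonzero, and this is Euler's
    f(-q) = (q; q)_oo ([theta_neg_qpoch_inf]). For a = 1/q, b = q^2 the terms n >= 2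
    are twice the terms of the series of the theorem, the terms n = 0 and n = 1 add
    up to twice the rational function in front of it, and the right side is
    f(1, q^3) / (q; q)_oo = 2 f(q^3, q^9) / (q; q)_oo ([triangular_theta]). This is
    the first equality ([slater_sum]); the second is the triple product for
    f(q^3, q^9) in base q^12 ([jacobi_triple_product]), which is the limit n -> oo of
    the finite form. Every exchange of limit and sum is an instance of dominated
    convergence for series ([tannery]). *)

(** * Limits of complex sequences *)

Definition tends (u : nat -> C) (l : C) : Prop :=
  forall eps : R, (0 < eps)%R ->
  exists N : nat, forall n : nat, (N <= n)%nat -> (Cmod (u n - l) < eps)%R.

Lemma tends_filterlim (u : nat -> C) (l : C) :
  tends u l <-> filterlim u eventually (locally (T := C_UniformSpace) l).
Proof.
  split.
  - intros H P HP.
    change (locally (T := C_NormedModule) l P) in HP.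
    apply (locally_norm_le_locally (V := C_NormedModule)) in HP.
    destruct HP as [eps HP].
    destruct (H eps (cond_pos eps)) as [N HN].
    exists N. intros n Hn. apply HP. exact (HN n Hn).
  - intros H eps Heps.
    apply (H (fun y => (Cmod (y - l) < eps)%R)).
    change (locally (T := C_NormedModule) l (fun y => (Cmod (y - l) < eps)%R)).
    apply locally_le_locally_norm.
    exists (mkposreal eps Heps). intros y Hy. exact Hy.
Qed.

Lemma tends_unique (u : nat -> C) (l l' : C) : tends u l -> tends u l' -> l = l'.
Proof.
  intros H H'. apply tends_filterlim in H. apply tends_filterlim in H'.
  exact (filterlim_locally_unique (V := C_NormedModule) u l l' H H').
Qed.

Lemma tends_ext_ge (N : nat) (u v : nat -> C) (l : C) :
  (forall n, (N <= n)%nat -> u n = v n) -> tends u l -> tends v l.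
Proof.
  intros E H eps Heps. destruct (H eps Heps) as [M HM].
  exists (Nat.max N M). intros n Hn. rewrite <- E by lia. apply HM. lia.
Qed.

Lemma tends_ext (u v : nat -> C) (l : C) :
  (forall n, u n = v n) -> tends u l -> tends v l.
Proof. intros E. apply (tends_ext_ge 0). intros n _. apply E. Qed.

Lemma tends_const (c : C) : tends (fun _ => c) c.
Proof.
  intros eps Heps. exists O. intros n _.
  replace (c - c) with (RtoC 0) by ring. rewrite Cmod_0. exact Heps.
Qed.

Lemma tends_subseq (phi : nat -> nat) (u : nat -> C) (l : C) :
  (forall M, exists N, forall n, (N <= n)%nat -> (M <= phi n)%nat) ->
  tends u l -> tends (fun n => u (phi n)) l.
Proof.
  intros Hphi H eps Heps. destruct (H eps Heps) as [M HM].
  destruct (Hphi M) as [N HN]. exists N. intros n Hn. apply HM, HN, Hn.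
Qed.

Lemma tends_plus (u v : nat -> C) (l m : C) :
  tends u l -> tends v m -> tends (fun n => u n + v n) (l + m).
Proof.
  intros Hu Hv eps Heps.
  destruct (Hu (eps / 2)%R) as [N HN]; [lra|].
  destruct (Hv (eps / 2)%R) as [M HM]; [lra|].
  exists (Nat.max N M). intros n Hn.
  specialize (HN n ltac:(lia)). specialize (HM n ltac:(lia)).
  replace (u n + v n - (l + m)) with ((u n - l) + (v n - m)) by ring.
  eapply Rle_lt_trans; [apply Cmod_triangle|]. lra.
Qed.

Lemma tends_scal (c : C) (u : nat -> C) (l : C) :
  tends u l -> tends (fun n => c * u n) (c * l).
Proof.
  intros H eps Heps.
  assert (Hc := Cmod_ge_0 c).
  destruct (H (eps / (Cmod c + 1))%R) as [N HN].
  { apply Rdiv_lt_0_compat; lra. }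
  exists N. intros n Hn. specialize (HN n Hn).
  replace (c * u n - c * l) with (c * (u n - l)) by ring.
  rewrite Cmod_mult.
  assert (H1 : (Cmod (u n - l) * (Cmod c + 1) < eps)%R).
  { apply Rlt_div_r in HN; lra. }
  assert (H2 := Cmod_ge_0 (u n - l)). nra.
Qed.

Lemma tends_bounded (u : nat -> C) (l : C) :
  tends u l -> exists N, forall n, (N <= n)%nat -> (Cmod (u n) <= Cmod l + 1)%R.
Proof.
  intros H. destruct (H 1%R Rlt_0_1) as [N HN]. exists N. intros n Hn.
  specialize (HN n Hn). replace (u n) with (l + (u n - l)) by ring.
  eapply Rle_trans; [apply Cmod_triangle|]. lra.
Qed.

Lemma tends_mult (u v : nat -> C) (l m : C) :
  tends u l -> tends v m -> tends (fun n => u n * v n) (l * m).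
Proof.
  intros Hu Hv eps Heps.
  assert (Hl := Cmod_ge_0 l). assert (Hm := Cmod_ge_0 m).
  destruct (tends_bounded _ _ Hv) as [P HP].
  destruct (Hu (eps / (2 * (Cmod m + 1)))%R) as [N HN].
  { apply Rdiv_lt_0_compat; lra. }
  destruct (Hv (eps / (2 * (Cmod l + 1)))%R) as [M HM].
  { apply Rdiv_lt_0_compat; lra. }
  exists (Nat.max P (Nat.max N M)). intros n Hn.
  specialize (HN n ltac:(lia)). specialize (HM n ltac:(lia)).
  specialize (HP n ltac:(lia)).
  apply Rlt_div_r in HN; [|lra]. apply Rlt_div_r in HM; [|lra].
  replace (u n * v n - l * m) with ((u n - l) * v n + l * (v n - m)) by ring.
  eapply Rle_lt_trans; [apply Cmod_triangle|]. rewrite !Cmod_mult.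
  assert (H1 := Cmod_ge_0 (u n - l)). assert (H2 := Cmod_ge_0 (v n - m)). nra.
Qed.

(** The uniform bound on the inverses keeps [u] away from zero, so the limit is
    nonzero without a separate argument. *)
Lemma tends_inv (B : R) (u : nat -> C) (l : C) :
  (forall n, u n <> 0) -> (forall n, (Cmod (/ u n) <= B)%R) -> tends u l ->
  l <> 0 /\ tends (fun n => / u n) (/ l).
Proof.
  intros Hnz HB Hu.
  assert (HB0 : (0 < B)%R).
  { eapply Rlt_le_trans; [|apply (HB O)]. rewrite Cmod_inv by apply Hnz.
    apply Rinv_0_lt_compat, Cmod_gt_0, Hnz. }
  assert (Hlow : forall n, (/ B <= Cmod (u n))%R).
  { intros n. rewrite <- (Rinv_inv (Cmod (u n))). apply Rinv_le_contravar.
    - apply Rinv_0_lt_compat, Cmod_gt_0, Hnz.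
    - rewrite <- Cmod_inv by apply Hnz. apply HB. }
  assert (Hl : l <> 0).
  { intros ->. destruct (Hu (/ B)%R) as [N HN].
    { apply Rinv_0_lt_compat; lra. }
    specialize (HN N (le_n _)). specialize (Hlow N).
    replace (u N - 0) with (u N) in HN by ring. lra. }
  split; [exact Hl|].
  intros eps Heps.
  assert (Hl' : (0 < Cmod l)%R) by (apply Cmod_gt_0; exact Hl).
  destruct (Hu (eps * Cmod l / B)%R) as [N HN].
  { apply Rdiv_lt_0_compat; [|lra]. apply Rmult_lt_0_compat; lra. }
  exists N. intros n Hn. specialize (HN n Hn).
  replace (/ u n - / l) with (/ u n * / l * (- (u n - l))).
  2: { field. split; [exact Hl | apply Hnz]. }
  rewrite !Cmod_mult, Cmod_opp, (Cmod_inv l) by exact Hl.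
  apply Rlt_div_r in HN; [|lra].
  assert (H1 := HB n). assert (H2 := Cmod_ge_0 (u n - l)).
  assert (H3 := Cmod_ge_0 (/ u n)).
  apply Rmult_lt_reg_r with (Cmod l); [lra|].
  replace (Cmod (/ u n) * / Cmod l * Cmod (u n - l) * Cmod l)%R
    with (Cmod (/ u n) * Cmod (u n - l))%R by (field; lra).
  nra.
Qed.

Lemma tends_0_le (M : nat -> R) (u : nat -> C) :
  (forall n, (Cmod (u n) <= M n)%R) -> is_lim_seq M 0 -> tends u 0.
Proof.
  intros Hle HM eps Heps.
  apply is_lim_seq_spec in HM.
  destruct (HM (mkposreal eps Heps)) as [N HN]. exists N. intros n Hn.
  specialize (HN n Hn). simpl in HN.
  replace (u n - 0) with (u n) by ring.
  eapply Rle_lt_trans; [apply Hle|]. apply Rabs_def2 in HN. lra.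
Qed.

(** * Finite sums *)

(** The bound is exclusive, so that empty sums exist and index shifts need no
    predecessor; [sum_n] includes its last index. *)
Fixpoint csum (f : nat -> C) (n : nat) : C :=
  match n with
  | O => 0
  | S m => csum f m + f m
  end.

Lemma csum_ext (f g : nat -> C) (n : nat) :
  (forall k, (k < n)%nat -> f k = g k) -> csum f n = csum g n.
Proof.
  induction n as [|n IH]; intros E; [reflexivity|]. simpl.
  rewrite IH by (intros k Hk; apply E; lia). rewrite E by lia. reflexivity.
Qed.

Lemma csum_plus (f g : nat -> C) (n : nat) :
  csum (fun k => f k + g k) n = csum f n + csum g n.
Proof. induction n as [|n IH]; simpl; [ring|]. rewrite IH. ring. Qed.

Lemma csum_scal (c : C) (f : nat -> C) (n : nat) :
  csum (fun k => c * f k) n = c * csum f n.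
Proof. induction n as [|n IH]; simpl; [ring|]. rewrite IH. ring. Qed.

Lemma csum_first (f : nat -> C) (n : nat) :
  csum f (S n) = f O + csum (fun k => f (S k)) n.
Proof.
  induction n as [|n IH]; [simpl; ring|].
  change (csum f (S (S n))) with (csum f (S n) + f (S n)). rewrite IH.
  simpl. ring.
Qed.

Lemma csum_zero (n : nat) : csum (fun _ => 0) n = 0.
Proof. induction n as [|n IH]; simpl; [reflexivity|]. rewrite IH. ring. Qed.

Lemma csum_telescope (U : nat -> C) (n : nat) :
  csum (fun k => U k - U (S k)) n = U O - U n.
Proof. induction n as [|n IH]; simpl; [ring|]. rewrite IH. ring. Qed.

(** Both sides run over the pairs r <= n < M; on the right n = k + r. *)
Lemma csum_triangle (F : nat -> nat -> C) (M : nat) :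
  csum (fun n => csum (F n) (S n)) M
  = csum (fun r => csum (fun k => F (k + r)%nat r) (M - r)) M.
Proof.
  induction M as [|M IH]; [reflexivity|].
  change (csum (fun n => csum (F n) (S n)) (S M))
    with (csum (fun n => csum (F n) (S n)) M + csum (F M) (S M)).
  rewrite IH.
  change (csum (F M) (S M)) with (csum (F M) M + F M M).
  rewrite Cplus_assoc, <- csum_plus.
  change (csum (fun r => csum (fun k => F (k + r)%nat r) (S M - r)) (S M))
    with (csum (fun r => csum (fun k => F (k + r)%nat r) (S M - r)) M
          + csum (fun k => F (k + M)%nat M) (S M - M)).
  f_equal.
  - apply csum_ext. intros r Hr.
    replace (S M - r)%nat with (S (M - r)) by lia. simpl.
    do 2 f_equal. lia.
  - replace (S M - M)%nat with 1%nat by lia. simpl. ring.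
Qed.

(** A sum over the integer interval from -n to m, cut as [theta] is: the part
    z >= 0 and the part z <= -1. *)
Lemma csum_bilateral (y : Z -> C) (m n : nat) :
  csum (fun k => y (Z.of_nat k - Z.of_nat n)%Z) (S (m + n))
  = csum (fun r => y (Z.of_nat r)) (S m)
    + csum (fun j => y (- Z.of_nat (S j))%Z) n.
Proof.
  induction n as [|n IH].
  - rewrite Nat.add_0_r. simpl (csum _ 0). rewrite Cplus_0_r.
    apply csum_ext. intros k _. f_equal. lia.
  - rewrite Nat.add_succ_r, csum_first.
    rewrite (csum_ext _ (fun k => y (Z.of_nat k - Z.of_nat n)%Z)).
    2: { intros k _. f_equal. lia. }
    rewrite IH.
    change (csum (fun j => y (- Z.of_nat (S j))%Z) (S n))
      with (csum (fun j => y (- Z.of_nat (S j))%Z) n + y (- Z.of_nat (S n))%Z).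
    replace (Z.of_nat 0 - Z.of_nat (S n))%Z with (- Z.of_nat (S n))%Z by lia.
    ring.
Qed.

(** * Series *)

Lemma sum_n_csum (a : nat -> C) (n : nat) :
  sum_n (G := C_AbelianMonoid) a n = csum a (S n).
Proof.
  induction n as [|n IH].
  - rewrite sum_O. simpl. ring.
  - rewrite sum_Sn, IH. reflexivity.
Qed.

Lemma is_series_tends (a : nat -> C) (l : C) :
  is_series (K := C_AbsRing) (V := C_NormedModule) a l <-> tends (csum a) l.
Proof.
  split.
  - intros H. apply tends_filterlim in H.
    intros eps Heps. destruct (H eps Heps) as [N HN]. exists (S N).
    intros n Hn. destruct n as [|n]; [lia|].
    rewrite <- sum_n_csum. apply HN. lia.
  - intros H. apply tends_filterlim.
    apply (tends_ext (fun n => csum a (S n))).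
    { intros n. symmetry. apply sum_n_csum. }
    apply (tends_subseq S); [|exact H].
    intros M. exists M. intros n Hn. lia.
Qed.

Lemma CSeries_eq (a : nat -> C) (l : C) : tends (csum a) l -> CSeries a = l.
Proof.
  intros H. unfold CSeries. apply (iota_unique (K := C_AbsRing) (V := C_CompleteNormedModule)).
  - intros y Hy. apply is_series_tends in Hy. exact (tends_unique _ _ _ Hy H).
  - apply is_series_tends. exact H.
Qed.

Lemma qpoch_inf_eq (a q l : C) : tends (qpoch a q) l -> qpoch_inf a q = l.
Proof.
  intros H. unfold qpoch_inf. apply (iota_unique (K := C_AbsRing) (V := C_CompleteNormedModule)).
  - intros y Hy.
    change (filterlim (qpoch a q) eventually (locally (T := C_UniformSpace) y)) in Hy.
    apply tends_filterlim in Hy. exact (tends_unique _ _ _ Hy H).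
  - change (filterlim (qpoch a q) eventually (locally (T := C_UniformSpace) l)).
    apply tends_filterlim. exact H.
Qed.

Lemma CSeries_dominated (a : nat -> C) (M : nat -> R) :
  (forall n, (Cmod (a n) <= M n)%R) -> ex_series M -> tends (csum a) (CSeries a).
Proof.
  intros Hle HM.
  destruct (ex_series_le (K := C_AbsRing) (V := C_CompleteNormedModule) a M Hle HM)
    as [l Hl].
  apply is_series_tends in Hl. rewrite (CSeries_eq a l Hl). exact Hl.
Qed.

Lemma csum_tail_le (u : nat -> C) (M : nat -> R) (K m : nat) :
  (forall k, (Cmod (u k) <= M k)%R) ->
  (Cmod (csum u (S K + m) - csum u (S K)) <= sum_n M (K + m) - sum_n M K)%R.
Proof.
  intros H. induction m as [|m IH].
  - rewrite !Nat.add_0_r.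
    replace (csum u (S K) - csum u (S K)) with (RtoC 0) by ring.
    rewrite Cmod_0. lra.
  - rewrite !Nat.add_succ_r, sum_Sn.
    change (csum u (S (S K + m))) with (csum u (S K + m) + u (S K + m)%nat).
    replace (csum u (S K + m) + u (S K + m)%nat - csum u (S K))
      with ((csum u (S K + m) - csum u (S K)) + u (S K + m)%nat) by ring.
    eapply Rle_trans; [apply Cmod_triangle|].
    specialize (H (S K + m)%nat). simpl in *. unfold plus in *. simpl in *. lra.
Qed.

Lemma csum_tends (f : nat -> nat -> C) (g : nat -> C) (K : nat) :
  (forall k, tends (fun n => f n k) (g k)) ->
  tends (fun n => csum (f n) K) (csum g K).
Proof.
  intros H. induction K as [|K IH]; simpl; [apply tends_const|].
  apply tends_plus; [exact IH | apply H].
Qed.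

(** Dominated convergence for series. Beyond a cutoff K all the sums are within
    a tail of the majorant, and below K there are finitely many terms. The sums
    are truncated at any [phi n >= n] because the finite identities below have
    n or n + 1 terms. *)
Lemma tannery (f : nat -> nat -> C) (g : nat -> C) (M : nat -> R)
    (phi : nat -> nat) (l : C) :
  (forall n k, (Cmod (f n k) <= M k)%R) -> ex_series M ->
  (forall k, tends (fun n => f n k) (g k)) ->
  (forall n, (n <= phi n)%nat) ->
  tends (csum g) l ->
  tends (fun n => csum (f n) (phi n)) l.
Proof.
  intros Hle [s Hs] Hlim Hphi Hl eps Heps.
  destruct (Hl (eps / 3)%R) as [K1 HK1]; [lra|].
  assert (Hs' : is_lim_seq (sum_n M) s) by exact Hs.
  apply is_lim_seq_spec in Hs'.
  assert (He : (0 < eps / 6)%R) by lra.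
  destruct (Hs' (mkposreal _ He)) as [K2 HK2]. simpl in HK2.
  set (K := Nat.max K1 K2).
  destruct (csum_tends f g (S K) Hlim (eps / 3)%R) as [N HN]; [lra|].
  exists (Nat.max N (S K)). intros n Hn.
  specialize (HN n ltac:(lia)). specialize (HK1 (S K) ltac:(lia)).
  specialize (Hphi n).
  assert (HT := csum_tail_le (f n) M K (phi n - S K) (Hle n)).
  replace (S K + (phi n - S K))%nat with (phi n) in HT by lia.
  assert (HA := HK2 (K + (phi n - S K))%nat ltac:(lia)).
  assert (HB := HK2 K ltac:(lia)).
  apply Rabs_def2 in HA. apply Rabs_def2 in HB.
  replace (csum (f n) (phi n) - l)
    with ((csum (f n) (phi n) - csum (f n) (S K))
          + ((csum (f n) (S K) - csum g (S K)) + (csum g (S K) - l))) by ring.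
  eapply Rle_lt_trans; [apply Cmod_triangle|].
  assert (HC := Cmod_triangle (csum (f n) (S K) - csum g (S K)) (csum g (S K) - l)).
  lra.
Qed.

(** * q-Pochhammer symbols *)

Lemma Cmod_pow_lt_1 (q : C) (n : nat) :
  (Cmod q < 1)%R -> (1 <= n)%nat -> (Cmod (q ^ n) < 1)%R.
Proof.
  intros Hq Hn. rewrite Cmod_pow.
  apply pow_lt_1_compat; [split; [apply Cmod_ge_0 | exact Hq] | lia].
Qed.

Lemma one_minus_neq_0 (x : C) : (Cmod x < 1)%R -> 1 - x <> 0.
Proof.
  intros H E. replace x with (RtoC 1) in H.
  - rewrite Cmod_1 in H. lra.
  - replace x with (1 - (1 - x)) by ring. rewrite E. ring.
Qed.

Lemma one_minus_pow_neq_0 (q : C) (n : nat) :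
  (Cmod q < 1)%R -> 1 - q * q ^ n <> 0.
Proof.
  intros H. apply one_minus_neq_0. rewrite <- Cpow_S.
  apply Cmod_pow_lt_1; [exact H | lia].
Qed.

Lemma qpoch_neq_0 (q : C) (n : nat) : (Cmod q < 1)%R -> qpoch q q n <> 0.
Proof.
  intros H. induction n as [|n IH]; simpl.
  - exact C1_nz.
  - apply Cmult_neq_0; [exact IH | apply one_minus_pow_neq_0, H].
Qed.

Lemma qpoch_first (a q : C) (n : nat) :
  qpoch a q (S n) = (1 - a) * qpoch (a * q) q n.
Proof.
  induction n as [|n IH]; [simpl; ring|].
  change (qpoch a q (S (S n))) with (qpoch a q (S n) * (1 - a * q ^ S n)).
  rewrite IH. simpl. ring.
Qed.

(** One factor of an infinite product: 1 + c rho^n <= exp (c rho^n), and the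
    exponents add up to a partial geometric sum. *)
Lemma exp_geom_step (c x rho : R) (n : nat) :
  (0 <= x)%R -> (0 <= rho < 1)%R ->
  (x <= exp (c * (1 - rho ^ n) / (1 - rho)))%R ->
  (x * (1 + c * rho ^ n) <= exp (c * (1 - rho ^ S n) / (1 - rho)))%R.
Proof.
  intros Hx Hrho H.
  replace (c * (1 - rho ^ S n) / (1 - rho))%R
    with (c * (1 - rho ^ n) / (1 - rho) + c * rho ^ n)%R by (simpl; field; lra).
  rewrite exp_plus.
  assert (H1 := exp_ineq1_le (c * rho ^ n)).
  assert (H2 := exp_pos (c * (1 - rho ^ n) / (1 - rho))).
  apply Rle_trans with (x * exp (c * rho ^ n))%R.
  - apply Rmult_le_compat_l; assumption.
  - apply Rmult_le_compat_r; [left; apply exp_pos | exact H].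
Qed.

Lemma exp_geom_le (c rho : R) (n : nat) :
  (0 <= c)%R -> (0 <= rho < 1)%R ->
  (exp (c * (1 - rho ^ n) / (1 - rho)) <= exp (c / (1 - rho)))%R.
Proof.
  intros Hc Hrho.
  assert (H : (c * (1 - rho ^ n) / (1 - rho) <= c / (1 - rho))%R).
  { apply Rmult_le_compat_r; [left; apply Rinv_0_lt_compat; lra|].
    assert (H := pow_le rho n (proj1 Hrho)). nra. }
  destruct (Rle_lt_or_eq_dec _ _ H) as [L | ->]; [|lra].
  left. apply exp_increasing, L.
Qed.

Lemma qpoch_bounded (a q : C) :
  (Cmod q < 1)%R -> exists B, forall n, (Cmod (qpoch a q n) <= B)%R.
Proof.
  intros Hq. exists (exp (Cmod a / (1 - Cmod q))). intros n.
  assert (Hq0 := Cmod_ge_0 q).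
  eapply Rle_trans; [|apply (exp_geom_le _ _ n); [apply Cmod_ge_0 | lra]].
  induction n as [|n IH].
  - simpl. rewrite Cmod_1.
    replace (Cmod a * (1 - 1) / (1 - Cmod q))%R with 0%R by (field; lra).
    rewrite exp_0. lra.
  - eapply Rle_trans;
      [|apply (exp_geom_step _ _ _ n (Cmod_ge_0 _) (conj Hq0 Hq) IH)].
    simpl (qpoch _ _ _). rewrite Cmod_mult.
    apply Rmult_le_compat_l; [apply Cmod_ge_0|].
    eapply Rle_trans; [apply Cmod_triangle|].
    rewrite Cmod_1, Cmod_opp, Cmod_mult, Cmod_pow. lra.
Qed.

(** Each inverse factor satisfies
    1 / (1 - rho^(n+1)) <= 1 + rho^n / (1 - rho), so the product of the inverses
    is bounded by the same exponential estimate as [qpoch]. In the limit this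
    gives (q; q)_oo <> 0. *)
Lemma inv_qpoch_bounded (q : C) :
  (Cmod q < 1)%R -> exists B, forall n, (Cmod (/ qpoch q q n) <= B)%R.
Proof.
  intros Hq. exists (exp (/ (1 - Cmod q) / (1 - Cmod q))). intros n.
  assert (Hq0 := Cmod_ge_0 q).
  assert (Hc : (0 < / (1 - Cmod q))%R) by (apply Rinv_0_lt_compat; lra).
  eapply Rle_trans; [|apply (exp_geom_le _ _ n); lra].
  induction n as [|n IH].
  - simpl. rewrite Cmod_inv by exact C1_nz. rewrite Cmod_1, Rinv_1.
    replace (/ (1 - Cmod q) * (1 - 1) / (1 - Cmod q))%R with 0%R by (field; lra).
    rewrite exp_0. lra.
  - eapply Rle_trans;
      [|apply (exp_geom_step _ _ _ n (Cmod_ge_0 _) (conj Hq0 Hq) IH)].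
    simpl (qpoch _ _ _).
    assert (Hn := one_minus_pow_neq_0 q n Hq).
    replace (/ (qpoch q q n * (1 - q * q ^ n)))
      with (/ qpoch q q n * / (1 - q * q ^ n))
      by (field; split; [exact Hn | apply qpoch_neq_0, Hq]).
    rewrite Cmod_mult.
    apply Rmult_le_compat_l; [apply Cmod_ge_0|].
    rewrite Cmod_inv by exact Hn.
    set (rho := Cmod q) in *.
    assert (Hp : (0 <= rho ^ n <= 1)%R).
    { split; [apply pow_le, Hq0|].
      rewrite <- (pow1 n). apply pow_incr. lra. }
    assert (Hlow : (1 - rho * rho ^ n <= Cmod (1 - q * q ^ n))%R).
    { assert (H := Cmod_triangle (1 - q * q ^ n) (q * q ^ n)).
      replace (1 - q * q ^ n + q * q ^ n) with (RtoC 1) in H by ring.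
      rewrite Cmod_1, Cmod_mult, Cmod_pow in H. fold rho in H. lra. }
    assert (Hpos : (1 - rho <= 1 - rho * rho ^ n)%R) by nra.
    apply Rle_trans with (/ (1 - rho * rho ^ n))%R.
    + apply Rinv_le_contravar; lra.
    + apply Rmult_le_reg_r with (1 - rho * rho ^ n)%R; [lra|].
      rewrite Rinv_l by lra.
      apply Rle_trans with ((1 + / (1 - rho) * (rho * rho ^ n)) * (1 - rho * rho ^ n))%R.
      * assert (E : (/ (1 - rho) * (1 - rho) = 1)%R) by (apply Rinv_l; lra).
        set (y := (rho * rho ^ n)%R) in *.
        assert (0 <= y)%R by (unfold y; nra).
        assert (1 <= / (1 - rho) * (1 - y))%R by nra.
        nra.
      * apply Rmult_le_compat_r; [lra|].
        apply Rplus_le_compat_l, Rmult_le_compat_l; nra.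
Qed.

Lemma ex_series_geom_scal (c rho : R) :
  (0 <= rho < 1)%R -> ex_series (fun n => (c * rho ^ n)%R).
Proof.
  intros H. apply (ex_series_scal (K := R_AbsRing) (V := R_NormedModule)).
  apply ex_series_geom. rewrite Rabs_pos_eq; lra.
Qed.

(** The increments (a; q)_(n+1) - (a; q)_n = - a q^n (a; q)_n are dominated by a
    geometric series, so the product converges as a telescoping series. *)
Lemma qpoch_tends (a q : C) :
  (Cmod q < 1)%R -> tends (qpoch a q) (qpoch_inf a q).
Proof.
  intros Hq. destruct (qpoch_bounded a q Hq) as [B HB].
  assert (Hs : tends (csum (fun k => - a * q ^ k * qpoch a q k))
                 (CSeries (fun k => - a * q ^ k * qpoch a q k))).
  { apply (CSeries_dominated _ (fun k => (Cmod a * B * Cmod q ^ k)%R)).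
    - intros n. rewrite !Cmod_mult, Cmod_opp, Cmod_pow.
      assert (H1 := Cmod_ge_0 a). assert (H2 := pow_le _ n (Cmod_ge_0 q)).
      specialize (HB n).
      replace (Cmod a * B * Cmod q ^ n)%R with (Cmod a * Cmod q ^ n * B)%R by ring.
      apply Rmult_le_compat_l; [nra | exact HB].
    - apply ex_series_geom_scal. split; [apply Cmod_ge_0 | exact Hq]. }
  assert (Ht : tends (qpoch a q) (1 + CSeries (fun k => - a * q ^ k * qpoch a q k))).
  { apply (tends_ext (fun n => 1 + csum (fun k => - a * q ^ k * qpoch a q k) n)).
    - intros n. induction n as [|n IH]; simpl; [ring|]. rewrite <- IH. ring.
    - apply tends_plus; [apply tends_const | exact Hs]. }
  rewrite (qpoch_inf_eq _ _ _ Ht). exact Ht.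
Qed.

Lemma inv_qpoch_tends (q : C) :
  (Cmod q < 1)%R ->
  qpoch_inf q q <> 0 /\ tends (fun n => / qpoch q q n) (/ qpoch_inf q q).
Proof.
  intros Hq. destruct (inv_qpoch_bounded q Hq) as [B HB].
  apply (tends_inv B); [|exact HB|apply qpoch_tends, Hq].
  intros n. apply qpoch_neq_0, Hq.
Qed.

(** * Terms of the theta series *)

Definition tri (r : Z) : Z := (r * (r + 1) / 2)%Z.

Lemma tri_succ (r : Z) : tri (r + 1) = (tri r + r + 1)%Z.
Proof.
  unfold tri. replace ((r + 1) * (r + 1 + 1))%Z with (r * (r + 1) + (r + 1) * 2)%Z by ring.
  rewrite Z.div_add by lia. ring.
Qed.

Lemma tri_pred (r : Z) : (r * (r - 1) / 2 = tri r - r)%Z.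
Proof.
  assert (H := tri_succ (r - 1)).
  replace (r - 1 + 1)%Z with r in H by ring. rewrite H.
  unfold tri. replace ((r - 1) * (r - 1 + 1))%Z with (r * (r - 1))%Z by ring. ring.
Qed.

Lemma tri_double (r : Z) : (2 * tri r = r * (r + 1))%Z.
Proof.
  unfold tri. symmetry. apply Z.div_exact; [lia|].
  rewrite Zmod_even, Z.even_mul, Z.add_1_r, Z.even_succ.
  rewrite <- Z.negb_even. destruct (Z.even r); reflexivity.
Qed.

Lemma tri_ge (r : Z) : (0 <= tri r /\ r <= tri r)%Z.
Proof. assert (H := tri_double r). destruct (Z_le_gt_dec 0 r); split; nia. Qed.

Lemma theta_term_tri (a b : C) (r : Z) :
  theta_term a b r = a ^ Z.to_nat (tri r) * b ^ Z.to_nat (tri r - r).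
Proof. unfold theta_term. rewrite tri_pred. reflexivity. Qed.

Lemma theta_term_0 (a b : C) : theta_term a b 0 = 1.
Proof. unfold theta_term. simpl. ring. Qed.

Lemma theta_term_opp (a b : C) (r : Z) : theta_term a b (- r) = theta_term b a r.
Proof.
  unfold theta_term.
  replace (- r * (- r + 1))%Z with (r * (r - 1))%Z by ring.
  replace (- r * (- r - 1))%Z with (r * (r + 1))%Z by ring. ring.
Qed.

(** The recurrence c_(r+1) = a (ab)^r c_r for c_r = [theta_term a b r],
    multiplied by (ab)^(m - r) so that no negative power of ab occurs and the
    case ab = 0 is included. *)
Lemma theta_term_up (a b : C) (r : Z) (m d : nat) :
  (r + Z.of_nat d = Z.of_nat m)%Z ->
  a * (a * b) ^ m * theta_term a b r = (a * b) ^ d * theta_term a b (r + 1).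
Proof.
  intros E. rewrite !theta_term_tri, tri_succ, !Cpow_mult_l.
  destruct (tri_ge r) as [H1 H2]. destruct (tri_ge (r + 1)) as [H3 _].
  rewrite tri_succ in H3.
  transitivity (a ^ (S m + Z.to_nat (tri r)) * b ^ (m + Z.to_nat (tri r - r))).
  { rewrite !Cpow_add_r, Cpow_S. ring. }
  transitivity (a ^ (d + Z.to_nat (tri r + r + 1))
                * b ^ (d + Z.to_nat (tri r + r + 1 - (r + 1)))).
  { f_equal; [apply (f_equal (Cpow a)) | apply (f_equal (Cpow b))]; lia. }
  rewrite !Cpow_add_r. ring.
Qed.

(** The mirror image of [theta_term_up] under the exchange of a and b, which
    sends r to -r. *)
Lemma theta_term_down (a b : C) (r : Z) (m d : nat) :
  (Z.of_nat d = Z.of_nat m + r)%Z ->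
  b * (a * b) ^ m * theta_term a b r = (a * b) ^ d * theta_term a b (r - 1).
Proof.
  intros E.
  rewrite <- (theta_term_opp b a r), <- (theta_term_opp b a (r - 1)), (Cmult_comm a b).
  replace (- (r - 1))%Z with (- r + 1)%Z by ring.
  apply theta_term_up. lia.
Qed.

(** r(r+1)/2 + r(r-1)/2 = r^2: the weight q^(r^2) with q = ab turns the terms of
    f(a, b) into those of f(aq, bq). *)
Lemma theta_term_square (a b : C) (r : nat) :
  theta_term a b (Z.of_nat r) * (a * b) ^ (r * r)
  = theta_term (a * (a * b)) (b * (a * b)) (Z.of_nat r).
Proof.
  rewrite !theta_term_tri.
  assert (H := tri_double (Z.of_nat r)). destruct (tri_ge (Z.of_nat r)) as [H1 H2].
  set (A := Z.to_nat (tri (Z.of_nat r))).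
  set (D := Z.to_nat (tri (Z.of_nat r) - Z.of_nat r)).
  replace (r * r)%nat with (A + D)%nat.
  2: { unfold A, D. apply Nat2Z.inj.
       rewrite Nat2Z.inj_add, Nat2Z.inj_mul, !Z2Nat.id by lia. lia. }
  rewrite (Cpow_mult_l a (a * b)), (Cpow_mult_l b (a * b)), Cpow_add_r. ring.
Qed.

Lemma theta_term_square_neg (a b : C) (r : nat) :
  theta_term a b (- Z.of_nat r) * (a * b) ^ (r * r)
  = theta_term (a * (a * b)) (b * (a * b)) (- Z.of_nat r).
Proof.
  rewrite !theta_term_opp, (Cmult_comm a b). apply theta_term_square.
Qed.

(** The ratio of consecutive terms is a (ab)^n, which tends to 0; after some
    index N the terms are dominated by a geometric series of ratio 1/2. The
    index N depends on a, which may exceed 1 in modulus. *)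
Lemma theta_term_summable (a b : C) :
  (Cmod (a * b) < 1)%R -> ex_series (fun n => Cmod (theta_term a b (Z.of_nat n))).
Proof.
  intros Hq. set (Q := a * b) in *.
  assert (Hstep : forall n, theta_term a b (Z.of_nat (S n))
                  = a * Q ^ n * theta_term a b (Z.of_nat n)).
  { intros n. unfold Q. rewrite (theta_term_up a b (Z.of_nat n) n 0) by lia.
    replace (Z.of_nat n + 1)%Z with (Z.of_nat (S n)) by lia. simpl. ring. }
  assert (HN : exists N, forall n, (N <= n)%nat -> (Cmod (a * Q ^ n) <= / 2)%R).
  { assert (HL : is_lim_seq (fun n => (Cmod a * Cmod Q ^ n)%R) 0).
    { replace (Finite 0) with (Rbar_mult (Cmod a) 0).
      - apply is_lim_seq_scal_l, is_lim_seq_geom.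
        rewrite Rabs_pos_eq; [exact Hq | apply Cmod_ge_0].
      - simpl. f_equal. ring. }
    apply is_lim_seq_spec in HL.
    assert (Hh : (0 < / 2)%R) by lra.
    destruct (HL (mkposreal _ Hh)) as [N HN]. exists N. intros n Hn.
    specialize (HN n Hn). simpl in HN. apply Rabs_def2 in HN.
    rewrite Cmod_mult, Cmod_pow. lra. }
  destruct HN as [N HN].
  apply (ex_series_incr_n _ N).
  set (c := Cmod (theta_term a b (Z.of_nat N))).
  apply (ex_series_le (K := R_AbsRing) (V := R_CompleteNormedModule) _
           (fun k => (c * (/ 2) ^ k)%R)).
  - intros k. change (norm ?x) with (Rabs x).
    rewrite Rabs_pos_eq by apply Cmod_ge_0.
    induction k as [|k IH].
    + rewrite Nat.add_0_r. simpl. unfold c. lra.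
    + rewrite Nat.add_succ_r, Hstep, Cmod_mult.
      specialize (HN (N + k)%nat ltac:(lia)).
      simpl. assert (H := Cmod_ge_0 (theta_term a b (Z.of_nat (N + k)))).
      assert (H0 := Cmod_ge_0 (a * Q ^ (N + k))).
      apply Rle_trans with (/ 2 * Cmod (theta_term a b (Z.of_nat (N + k))))%R; nra.
  - apply ex_series_geom_scal. lra.
Qed.

(** * The finite triple product *)

(** The Gaussian binomial coefficient (N choose k)_q divided by (q; q)_N. *)
Definition binom_weight (q : C) (N k : nat) : C :=
  / (qpoch q q k * qpoch q q (N - k)).

(** Both Pascal rules for Gaussian binomials at once. They come from the two
    ways to split 1 - q^(N+1),
    as (1 - q^(N-k)) + q^(N-k) (1 - q^(k+1)) or with the two roles exchanged;
    the coefficients [alpha] and [beta] record the splitting. *)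
Lemma csum_pascal (q : C) (alpha beta x : nat -> C) (N : nat) :
  (Cmod q < 1)%R -> beta O = 1 -> alpha N = 1 ->
  (forall j d, N = (S j + d)%nat ->
     1 - q * q ^ N = beta (S j) * (1 - q * q ^ d) + alpha j * (1 - q * q ^ j)) ->
  (1 - q * q ^ N) * csum (fun k => x k * binom_weight q (S N) k) (S (S N))
  = csum (fun k => (beta k * x k + alpha k * x (S k)) * binom_weight q N k) (S N).
Proof.
  intros Hq Hb Ha Hmid.
  rewrite (csum_ext (fun k => (beta k * x k + alpha k * x (S k)) * binom_weight q N k)
             (fun k => beta k * x k * binom_weight q N k
                       + alpha k * x (S k) * binom_weight q N k))
    by (intros; ring).
  rewrite csum_plus, csum_first.
  rewrite (csum_first (fun k => beta k * x k * binom_weight q N k)).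
  change (csum ?f (S N)) with (csum f N + f N). cbv beta.
  rewrite Hb, Ha, !Cmult_plus_distr_l, <- csum_scal.
  assert (HP := fun n => qpoch_neq_0 q n Hq).
  assert (HD := fun n => one_minus_pow_neq_0 q n Hq).
  assert (Hlo : (1 - q * q ^ N) * binom_weight q (S N) 0 = binom_weight q N 0).
  { unfold binom_weight. rewrite !Nat.sub_0_r. simpl. field. auto. }
  assert (Hhi : (1 - q * q ^ N) * binom_weight q (S N) (S N) = binom_weight q N N).
  { unfold binom_weight. rewrite !Nat.sub_diag. simpl. field. auto. }
  rewrite (csum_ext (fun k => (1 - q * q ^ N) * (x (S k) * binom_weight q (S N) (S k)))
             (fun k => beta (S k) * x (S k) * binom_weight q N (S k)
                       + alpha k * x (S k) * binom_weight q N k)).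
  - rewrite csum_plus, <- Hlo, <- Hhi. ring.
  - intros k Hk. rewrite (Hmid k (N - S k)%nat) by lia.
    unfold binom_weight.
    replace (S N - S k)%nat with (S (N - S k)) by lia.
    replace (N - k)%nat with (S (N - S k)) by lia.
    simpl (qpoch q q (S _)). field. auto.
Qed.

(** Induction on n and on m: a factor 1 + a (ab)^m or 1 + b (ab)^n shifts the
    theta terms by one place up or down, and a Pascal rule absorbs the shift. *)
Lemma finite_triple_product (a b : C) (m n : nat) :
  (Cmod (a * b) < 1)%R ->
  qpoch (- a) (a * b) m * qpoch (- b) (a * b) n
  = qpoch (a * b) (a * b) (m + n)
    * csum (fun k => theta_term a b (Z.of_nat k - Z.of_nat n)
                     * binom_weight (a * b) (m + n) k) (S (m + n)).
Proof.
  intros Hq. induction n as [|n IHn].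
  - induction m as [|m IHm].
    + unfold theta_term, binom_weight. simpl. field.
    + simpl (qpoch _ _ (S m)).
      replace (qpoch (- a) (a * b) m * (1 - - a * (a * b) ^ m) * qpoch (- b) (a * b) 0)
        with ((1 + a * (a * b) ^ m) * (qpoch (- a) (a * b) m * qpoch (- b) (a * b) 0)) by ring.
      rewrite IHm. rewrite !Nat.add_0_r.
      simpl (qpoch _ _ (S m)).
      rewrite <- Cmult_assoc.
      rewrite (csum_pascal (a * b) (fun k => (a * b) ^ (m - k)) (fun _ => 1)); auto.
      * rewrite Cmult_comm, <- Cmult_assoc. f_equal.
        rewrite Cmult_comm, <- csum_scal.
        apply csum_ext. intros k Hk.
        replace (Z.of_nat (S k) - Z.of_nat 0)%Z
          with (Z.of_nat k - Z.of_nat 0 + 1)%Z by lia.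
        rewrite <- (theta_term_up a b _ m) by lia. ring.
      * rewrite Nat.sub_diag. reflexivity.
      * intros j d ->. replace (S j + d - j)%nat with (S d) by lia.
        rewrite Cpow_add_r, !Cpow_S. ring.
  - simpl (qpoch _ _ (S n)).
    replace (qpoch (- a) (a * b) m * (qpoch (- b) (a * b) n * (1 - - b * (a * b) ^ n)))
      with ((1 + b * (a * b) ^ n) * (qpoch (- a) (a * b) m * qpoch (- b) (a * b) n)) by ring.
    rewrite IHn. rewrite Nat.add_succ_r.
    simpl (qpoch _ _ (S _)).
    rewrite <- Cmult_assoc.
    rewrite (csum_pascal (a * b) (fun _ => 1) (fun k => (a * b) ^ k)); auto.
    + rewrite Cmult_comm, <- Cmult_assoc. f_equal.
      rewrite Cmult_comm, <- csum_scal.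
      apply csum_ext. intros k Hk.
      replace (Z.of_nat (S k) - Z.of_nat (S n))%Z
        with (Z.of_nat k - Z.of_nat n)%Z by lia.
      replace (Z.of_nat k - Z.of_nat (S n))%Z
        with (Z.of_nat k - Z.of_nat n - 1)%Z by lia.
      rewrite <- (theta_term_down a b _ n) by lia. ring.
    + intros j d ->. rewrite Cpow_add_r, !Cpow_S. ring.
Qed.

(** For r > n the truncated subtraction gives a value without meaning, which
    remains bounded; only r <= n is ever summed. *)
Definition centred_weight (q : C) (n r : nat) : C :=
  / (qpoch q q (n - r) * qpoch q q (n + r)).

(** In the language of Bailey pairs relative to 1: the left side is beta_n,
    with alpha_0 = 1 and alpha_r = c_r + c_(-r) for r >= 1, c_r = [theta_term a b r]. *)
Lemma symmetric_triple_product (a b : C) (n : nat) :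
  (Cmod (a * b) < 1)%R ->
  qpoch (- a) (a * b) n * qpoch (- b) (a * b) n / qpoch (a * b) (a * b) (2 * n)
  = csum (fun r => theta_term a b (Z.of_nat r) * centred_weight (a * b) n r) (S n)
    + csum (fun r => theta_term a b (- Z.of_nat (S r))
                     * centred_weight (a * b) n (S r)) n.
Proof.
  intros Hq. rewrite finite_triple_product by exact Hq.
  replace (2 * n)%nat with (n + n)%nat by lia.
  transitivity (csum (fun k => theta_term a b (Z.of_nat k - Z.of_nat n)
                     * binom_weight (a * b) (n + n) k) (S (n + n))).
  { field. apply qpoch_neq_0, Hq. }
  pose (y := fun z : Z => theta_term a b z
     * binom_weight (a * b) (n + n) (Z.to_nat (z + Z.of_nat n))).
  rewrite (csum_ext _ (fun k => y (Z.of_nat k - Z.of_nat n)%Z)).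
  2: { intros k Hk. unfold y. do 2 f_equal. lia. }
  rewrite (csum_bilateral y). unfold y, binom_weight, centred_weight. f_equal.
  - apply csum_ext. intros r Hr. f_equal.
    replace (Z.to_nat (Z.of_nat r + Z.of_nat n)) with (n + r)%nat by lia.
    replace (n + n - (n + r))%nat with (n - r)%nat by lia.
    f_equal. ring.
  - apply csum_ext. intros r Hr. f_equal.
    replace (Z.to_nat (- Z.of_nat (S r) + Z.of_nat n)) with (n - S r)%nat by lia.
    replace (n + n - (n - S r))%nat with (n + S r)%nat by lia.
    reflexivity.
Qed.

(** * Passing to the limit in bilateral sums *)

Lemma theta_term_summable_neg (a b : C) :
  (Cmod (a * b) < 1)%R ->
  ex_series (fun n => Cmod (theta_term a b (- Z.of_nat (S n)))).
Proof.
  intros Hq. rewrite (Cmult_comm a b) in Hq.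
  apply (ex_series_ext (fun n => Cmod (theta_term b a (Z.of_nat (S n))))).
  - intros n. rewrite theta_term_opp. reflexivity.
  - apply (ex_series_incr_1 (fun n => Cmod (theta_term b a (Z.of_nat n)))).
    apply theta_term_summable, Hq.
Qed.

Lemma theta_tends (a b : C) :
  (Cmod (a * b) < 1)%R ->
  tends (csum (fun n => theta_term a b (Z.of_nat n)))
    (CSeries (fun n => theta_term a b (Z.of_nat n)))
  /\ tends (csum (fun n => theta_term a b (- Z.of_nat (S n))))
       (CSeries (fun n => theta_term a b (- Z.of_nat (S n)))).
Proof.
  intros Hq. split.
  - apply (CSeries_dominated _ (fun n => Cmod (theta_term a b (Z.of_nat n)))).
    + intros n. lra.
    + apply theta_term_summable, Hq.
  - apply (CSeries_dominated _ (fun n => Cmod (theta_term a b (- Z.of_nat (S n))))).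
    + intros n. lra.
    + apply theta_term_summable_neg, Hq.
Qed.

Lemma tannery_weighted (c L : nat -> C) (W : nat -> nat -> C) (K : R)
    (phi : nat -> nat) (l : C) :
  ex_series (fun r => Cmod (c r)) ->
  (forall n r, (Cmod (W n r) <= K)%R) ->
  (forall r, tends (fun n => W n r) (L r)) ->
  (forall n, (n <= phi n)%nat) ->
  tends (csum (fun r => c r * L r)) l ->
  tends (fun n => csum (fun r => c r * W n r) (phi n)) l.
Proof.
  intros Hc HW HL Hphi Hl.
  apply (tannery (fun n r => c r * W n r) (fun r => c r * L r)
           (fun r => (K * Cmod (c r))%R)); auto.
  - intros n r. rewrite Cmod_mult, Rmult_comm.
    apply Rmult_le_compat_r; [apply Cmod_ge_0 | apply HW].
  - apply (ex_series_scal (K := R_AbsRing) (V := R_NormedModule)). exact Hc.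
  - intros r. apply tends_scal, HL.
Qed.

(** Both bilateral limits below have this form. The weights [W n r] are bounded, and their
    limits L r turn the terms of f(a, b) into those of f(a', b'). *)
Lemma theta_tannery (a b a' b' : C) (W : nat -> nat -> C) (L : nat -> C) (K : R) :
  (Cmod (a * b) < 1)%R -> (Cmod (a' * b') < 1)%R ->
  (forall n r, (Cmod (W n r) <= K)%R) ->
  (forall r, tends (fun n => W n r) (L r)) ->
  (forall r, theta_term a b (Z.of_nat r) * L r = theta_term a' b' (Z.of_nat r)) ->
  (forall r, theta_term a b (- Z.of_nat r) * L r = theta_term a' b' (- Z.of_nat r)) ->
  tends (fun n =>
    csum (fun r => theta_term a b (Z.of_nat r) * W n r) (S n)
    + csum (fun r => theta_term a b (- Z.of_nat (S r)) * W n (S r)) n)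
    (theta a' b').
Proof.
  intros Hq Hq' HW HL Epos Eneg.
  destruct (theta_tends a' b' Hq') as [Hpos Hneg].
  apply tends_plus.
  - apply (tannery_weighted _ L W K S).
    + apply theta_term_summable, Hq.
    + exact HW.
    + exact HL.
    + intros n. lia.
    + eapply tends_ext; [|exact Hpos]. intros n. apply csum_ext. intros r _.
      symmetry. apply Epos.
  - apply (tannery_weighted (fun r => theta_term a b (- Z.of_nat (S r)))
             (fun r => L (S r)) (fun n r => W n (S r)) K (fun n => n)).
    + apply theta_term_summable_neg, Hq.
    + intros n r. apply HW.
    + intros r. apply HL.
    + intros n. lia.
    + eapply tends_ext; [|exact Hneg]. intros n. apply csum_ext. intros r _.
      symmetry. apply Eneg.
Qed.

Lemma Cinv_mult (x y : C) : x <> 0 -> y <> 0 -> / (x * y) = / x * / y.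
Proof. intros Hx Hy. field. split; assumption. Qed.

Lemma inv_qpoch_tends_shift (q : C) (phi : nat -> nat) :
  (Cmod q < 1)%R ->
  (forall M, exists N, forall n, (N <= n)%nat -> (M <= phi n)%nat) ->
  tends (fun n => / qpoch q q (phi n)) (/ qpoch_inf q q).
Proof.
  intros Hq Hphi.
  apply (tends_subseq phi (fun n => / qpoch q q n)); [exact Hphi|].
  apply inv_qpoch_tends, Hq.
Qed.

Lemma inv_qpoch_pair_bounded (q : C) :
  (Cmod q < 1)%R ->
  exists B, (0 <= B)%R
    /\ forall m n, (Cmod (/ (qpoch q q m * qpoch q q n)) <= B)%R.
Proof.
  intros Hq. destruct (inv_qpoch_bounded q Hq) as [B HB].
  assert (HB0 : (0 <= B)%R) by (eapply Rle_trans; [apply Cmod_ge_0 | apply (HB O)]).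
  exists (B * B)%R. split; [nra|]. intros m n.
  rewrite Cinv_mult by (apply qpoch_neq_0, Hq). rewrite Cmod_mult.
  apply Rmult_le_compat; try apply Cmod_ge_0; apply HB.
Qed.

(** * The triple product identity *)

(** The limit of the finite triple product: with q = ab, the weights
    (q)_oo (q)_(2n) / ((q)_(n-r) (q)_(n+r)) tend to 1. *)
Theorem jacobi_triple_product (a b : C) :
  (Cmod (a * b) < 1)%R ->
  theta a b = qpoch_inf (- a) (a * b) * qpoch_inf (- b) (a * b)
              * qpoch_inf (a * b) (a * b).
Proof.
  intros Hq. set (Q := a * b).
  destruct (inv_qpoch_pair_bounded Q Hq) as [B [HB0 HB]].
  destruct (qpoch_bounded Q Q Hq) as [B' HB'].
  destruct (inv_qpoch_tends Q Hq) as [Hnz _].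
  assert (Hdouble : forall M, exists N, forall n, (N <= n)%nat -> (M <= 2 * n)%nat)
    by (intros M; exists M; intros; lia).
  apply (tends_unique (fun n => qpoch_inf Q Q *
    (qpoch (- a) Q n * qpoch (- b) Q n))).
  - apply (tends_ext (fun n =>
      csum (fun r => theta_term a b (Z.of_nat r)
        * (qpoch_inf Q Q * qpoch Q Q (2 * n) * centred_weight Q n r)) (S n)
      + csum (fun r => theta_term a b (- Z.of_nat (S r))
        * (qpoch_inf Q Q * qpoch Q Q (2 * n) * centred_weight Q n (S r))) n)).
    + intros n.
      transitivity (qpoch_inf Q Q * qpoch Q Q (2 * n)
        * (qpoch (- a) Q n * qpoch (- b) Q n / qpoch Q Q (2 * n))).
      * unfold Q. rewrite symmetric_triple_product by exact Hq.
        rewrite Cmult_plus_distr_l, <- !csum_scal.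
        f_equal; apply csum_ext; intros; ring.
      * field. apply qpoch_neq_0, Hq.
    + apply (theta_tannery a b a b
        (fun n r => qpoch_inf Q Q * qpoch Q Q (2 * n) * centred_weight Q n r)
        (fun _ => 1) (Cmod (qpoch_inf Q Q) * B' * B)); auto.
      * intros n r. rewrite !Cmod_mult. apply Rmult_le_compat.
        -- apply Rmult_le_pos; apply Cmod_ge_0.
        -- apply Cmod_ge_0.
        -- apply Rmult_le_compat_l; [apply Cmod_ge_0 | apply HB'].
        -- apply HB.
      * intros r.
        replace (RtoC 1) with (qpoch_inf Q Q * qpoch_inf Q Q
          * (/ qpoch_inf Q Q * / qpoch_inf Q Q)) by (field; exact Hnz).
        apply tends_mult.
        -- apply tends_scal, (tends_subseq (fun n => 2 * n)%nat); [exact Hdouble|].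
           apply qpoch_tends, Hq.
        -- apply (tends_ext (fun n => / qpoch Q Q (n - r) * / qpoch Q Q (n + r))).
           { intros n. symmetry. apply Cinv_mult; apply qpoch_neq_0, Hq. }
           apply tends_mult; apply inv_qpoch_tends_shift; try exact Hq;
             intros M; exists (M + r)%nat; intros; lia.
      * intros r. ring.
      * intros r. ring.
  - rewrite (Cmult_comm _ (qpoch_inf Q Q)).
    apply tends_scal, tends_mult; apply qpoch_tends, Hq.
Qed.

(** * The Durfee rectangle sum *)

Definition durfee_term (q : C) (s k : nat) : C :=
  q ^ (k * (k + s)) / (qpoch q q k * qpoch q q (k + s)).

(** The certificate which makes the difference of [durfee_term] at s and s + 1
    telescope in k. It vanishes at k = 0. *)
Definition durfee_flux (q : C) (s k : nat) : C :=
  (1 - q ^ k) * durfee_term q s k.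

Lemma durfee_step (q : C) (s k : nat) :
  (Cmod q < 1)%R ->
  durfee_term q s k - durfee_term q (S s) k
  = durfee_flux q s k - durfee_flux q s (S k).
Proof.
  intros Hq. unfold durfee_flux, durfee_term.
  rewrite Nat.add_succ_r. rewrite Nat.add_succ_l.
  simpl (qpoch q q (S _)).
  replace (k * S (k + s))%nat with (k * (k + s) + k)%nat by lia.
  replace (S k * S (k + s))%nat with (k * (k + s) + k + k + s + 1)%nat by lia.
  rewrite !Cpow_add_r, Cpow_S, Cpow_1_r.
  assert (H1 := one_minus_pow_neq_0 q k Hq).
  assert (H2 := one_minus_pow_neq_0 q (k + s) Hq).
  rewrite Cpow_add_r in H2.
  field. repeat split; auto; apply qpoch_neq_0, Hq.
Qed.

Lemma pow_le_exponent (rho : R) (m n : nat) :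
  (0 <= rho < 1)%R -> (m <= n)%nat -> (rho ^ n <= rho ^ m)%R.
Proof.
  intros H Hmn. replace n with (m + (n - m))%nat by lia. rewrite pow_add.
  assert (H1 := pow_le rho m (proj1 H)).
  assert (H2 : (rho ^ (n - m) <= 1)%R).
  { rewrite <- (pow1 (n - m)). apply pow_incr. lra. }
  nra.
Qed.

Lemma tends_pow_0 (c : R) (q : C) (u : nat -> C) :
  (Cmod q < 1)%R -> (forall n, (Cmod (u n) <= c * Cmod q ^ n)%R) -> tends u 0.
Proof.
  intros Hq H. apply (tends_0_le _ _ H).
  replace (Finite 0) with (Rbar_mult c 0) by (simpl; f_equal; ring).
  apply is_lim_seq_scal_l, is_lim_seq_geom.
  rewrite Rabs_pos_eq; [exact Hq | apply Cmod_ge_0].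
Qed.

(** By [durfee_step] the partial sums for s and for s + t differ by boundary
    terms only. With t = K both parts are accessible to dominated convergence:
    the boundary terms vanish, and in the sum for s + K only the term k = 0
    survives, 1 / (q; q)_(s+K). *)
Lemma durfee_sum (q : C) (s : nat) :
  (Cmod q < 1)%R -> tends (csum (durfee_term q s)) (/ qpoch_inf q q).
Proof.
  intros Hq. destruct (inv_qpoch_pair_bounded q Hq) as [B [HB0 HB]].
  assert (Hrho : (0 <= Cmod q < 1)%R) by (split; [apply Cmod_ge_0 | exact Hq]).
  assert (Hterm : forall t k j, (j <= k * (k + t))%nat ->
            (Cmod (durfee_term q t k) <= B * Cmod q ^ j)%R).
  { intros t k j Hj. unfold durfee_term, Cdiv.
    rewrite Cmod_mult, Cmod_pow, Rmult_comm.
    apply Rmult_le_compat; [apply Cmod_ge_0 | apply pow_le, Hrho | apply HB |].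
    apply pow_le_exponent; assumption. }
  assert (Hflux : forall t k j, (k <> 0 -> j <= k * (k + t))%nat ->
            (Cmod (durfee_flux q t k) <= 2 * B * Cmod q ^ j)%R).
  { intros t k j Hj. unfold durfee_flux.
    assert (Hp := pow_le _ j (proj1 Hrho)).
    destruct k as [|k].
    - simpl. replace (1 - 1) with (RtoC 0) by ring.
      rewrite Cmult_0_l, Cmod_0. nra.
    - rewrite Cmod_mult, Rmult_assoc.
      apply Rmult_le_compat; try apply Cmod_ge_0.
      + eapply Rle_trans; [apply Cmod_triangle|].
        rewrite Cmod_1, Cmod_opp.
        assert (H := Cmod_pow_lt_1 q (S k) Hq ltac:(lia)). lra.
      + apply Hterm, Hj. lia. }
  (* Summed over k < K, [durfee_step] leaves only the flux at K, since the flux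
     at 0 vanishes. *)
  assert (Htel : forall t K, csum (durfee_term q s) K
            = csum (durfee_term q (t + s)) K
              + - (1) * csum (fun i => durfee_flux q (i + s) K) t).
  { intros t K. induction t as [|t IH]; [simpl; ring|].
    rewrite IH. simpl (csum _ (S t)).
    assert (E : csum (durfee_term q (t + s)) K
                = csum (durfee_term q (S t + s)) K - durfee_flux q (t + s) K).
    { replace (csum (durfee_term q (S t + s)) K - durfee_flux q (t + s) K)
        with (csum (durfee_term q (S t + s)) K
              + (durfee_flux q (t + s) 0 - durfee_flux q (t + s) K))
        by (unfold durfee_flux; simpl; ring).
      rewrite <- csum_telescope, <- csum_plus. apply csum_ext. intros k _.
      rewrite <- durfee_step by exact Hq. simpl. ring. }
    rewrite E. ring. }
  apply (tends_ext (fun K => csum (durfee_term q (K + s)) K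
              + - (1) * csum (fun i => durfee_flux q (i + s) K) K)).
  { intros K. symmetry. apply Htel. }
  replace (/ qpoch_inf q q) with (/ qpoch_inf q q + - (1) * 0) by ring.
  apply tends_plus; [|apply tends_scal].
  - apply (tannery (fun K k => durfee_term q (K + s) k)
             (fun k => match k with O => / qpoch_inf q q | S _ => 0 end)
             (fun k => (B * Cmod q ^ k)%R) (fun K => K)).
    + intros K k. apply Hterm. nia.
    + apply ex_series_geom_scal, Hrho.
    + intros [|k].
      * apply (tends_ext (fun K => / qpoch q q (K + s))).
        { intros K. unfold durfee_term. simpl. field. apply qpoch_neq_0, Hq. }
        apply inv_qpoch_tends_shift; [exact Hq|].
        intros M. exists M. intros; lia.
      * apply (tends_pow_0 B q); [exact Hq|]. intros K. apply Hterm. nia.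
    + intros K. lia.
    + apply (tends_ext_ge 1 (fun _ => / qpoch_inf q q)); [|apply tends_const].
      intros [|K] HK; [lia|]. rewrite csum_first, csum_zero. ring.
  - apply (tannery (fun K i => durfee_flux q (i + s) K) (fun _ => 0)
             (fun i => (2 * B * Cmod q ^ i)%R) (fun K => K)).
    + intros K i. apply Hflux. nia.
    + apply ex_series_geom_scal, Hrho.
    + intros i. apply (tends_pow_0 (2 * B) q); [exact Hq|]. intros K. apply Hflux. nia.
    + intros K. lia.
    + apply (tends_ext (fun _ => 0)); [|apply tends_const].
      intros n. symmetry. apply csum_zero.
Qed.

Lemma durfee_partial_bounded (q : C) :
  (Cmod q < 1)%R ->
  exists K, forall s n, (Cmod (csum (durfee_term q s) n) <= K)%R.
Proof.
  intros Hq. destruct (inv_qpoch_pair_bounded q Hq) as [B [HB0 HB]].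
  assert (Hrho : (0 <= Cmod q < 1)%R) by (split; [apply Cmod_ge_0 | exact Hq]).
  exists (B / (1 - Cmod q))%R. intros s n.
  apply Rle_trans with (B * (1 - Cmod q ^ n) / (1 - Cmod q))%R.
  - induction n as [|n IH].
    + simpl. rewrite Cmod_0. right. field. lra.
    + simpl (csum _ _). eapply Rle_trans; [apply Cmod_triangle|].
      replace (B * (1 - Cmod q ^ S n) / (1 - Cmod q))%R
        with (B * (1 - Cmod q ^ n) / (1 - Cmod q) + B * Cmod q ^ n)%R
        by (simpl; field; lra).
      apply Rplus_le_compat; [exact IH|].
      unfold durfee_term, Cdiv. rewrite Cmod_mult, Cmod_pow, Rmult_comm.
      apply Rmult_le_compat; [apply Cmod_ge_0 | apply pow_le, Hrho | apply HB |].
      apply pow_le_exponent; [exact Hrho | nia].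
  - apply Rmult_le_compat_r; [left; apply Rinv_0_lt_compat; lra|].
    assert (H := pow_le _ n (proj1 Hrho)). nra.
Qed.

(** * Summing the finite triple product against q^(n^2) *)

(** Expand the summand by [symmetric_triple_product] and exchange the sums. With
    q = ab, the coefficient of the theta term of index r is
    q^(r^2) sum_k q^(k(k+2r)) / ((q)_k (q)_(k+2r)) = q^(r^2) / (q)_oo
    by [durfee_sum], and q^(r^2) changes f(a, b) into f(aq, bq). *)
Theorem bailey_theta_sum (a b : C) :
  (Cmod (a * b) < 1)%R ->
  tends (csum (fun n => (a * b) ^ (n * n)
           * (qpoch (- a) (a * b) n * qpoch (- b) (a * b) n
              / qpoch (a * b) (a * b) (2 * n))))
    (theta (a * (a * b)) (b * (a * b)) / qpoch_inf (a * b) (a * b)).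
Proof.
  intros Hq. set (q := a * b) in *.
  destruct (durfee_partial_bounded q Hq) as [K HK].
  assert (Hq0 := Cmod_ge_0 q).
  destruct (inv_qpoch_tends q Hq) as [Hnz _].
  set (W := fun N r : nat =>
    qpoch_inf q q * (q ^ (r * r) * csum (durfee_term q (2 * r)) (S N - r))).
  assert (HW : tends (fun N =>
    csum (fun r => theta_term a b (Z.of_nat r) * W N r) (S N)
    + csum (fun r => theta_term a b (- Z.of_nat (S r)) * W N (S r)) N)
    (theta (a * q) (b * q))).
  { apply (theta_tannery a b _ _ W (fun r => q ^ (r * r))
             (Cmod (qpoch_inf q q) * K)).
    - exact Hq.
    - replace (a * q * (b * q)) with (q * (q * q)) by (unfold q; ring).
      rewrite !Cmod_mult. nra.
    - intros N r. unfold W. rewrite Cmod_mult.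
      apply Rmult_le_compat_l; [apply Cmod_ge_0|].
      rewrite Cmod_mult, Cmod_pow.
      specialize (HK (2 * r)%nat (S N - r)%nat).
      assert (H1 := pow_le_exponent (Cmod q) 0 (r * r) (conj Hq0 Hq) ltac:(lia)).
      assert (H2 := Cmod_ge_0 (csum (durfee_term q (2 * r)) (S N - r))).
      simpl (_ ^ 0)%R in H1. nra.
    - intros r.
      replace (q ^ (r * r)) with (qpoch_inf q q * (q ^ (r * r) * / qpoch_inf q q))
        by (field; exact Hnz).
      apply tends_scal, tends_scal.
      apply (tends_subseq (fun N => S N - r)%nat); [|apply durfee_sum, Hq].
      intros M. exists (M + r)%nat. intros; lia.
    - intros r. apply theta_term_square.
    - intros r. apply theta_term_square_neg. }
  apply (tends_scal (/ qpoch_inf q q)) in HW.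
  rewrite Cmult_comm in HW.
  set (T := fun n => q ^ (n * n)
              * (qpoch (- a) q n * qpoch (- b) q n / qpoch q q (2 * n))).
  assert (Hshift : tends (fun N => csum T (S N))
                     (theta (a * q) (b * q) / qpoch_inf q q)).
  { eapply tends_ext; [|exact HW]. intros N. symmetry. cbv beta.
    assert (Hw : forall k r, q ^ ((k + r) * (k + r)) * centred_weight q (k + r) r
              = q ^ (r * r) * durfee_term q (2 * r) k).
    { intros k r. unfold centred_weight, durfee_term.
      replace (k + r - r)%nat with k by lia.
      replace (k + r + r)%nat with (k + 2 * r)%nat by lia.
      replace ((k + r) * (k + r))%nat with (r * r + k * (k + 2 * r))%nat by lia.
      rewrite Cpow_add_r. unfold Cdiv. ring. }
    rewrite (csum_ext T (fun n =>
        csum (fun r => theta_term a b (Z.of_nat r)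
                       * (q ^ (n * n) * centred_weight q n r)) (S n)
        + csum (fun r => theta_term a b (- Z.of_nat (S r))
                       * (q ^ (n * n) * centred_weight q n (S r))) n)).
    2: { intros n _. unfold T, q.
         rewrite symmetric_triple_product by exact Hq.
         rewrite Cmult_plus_distr_l, <- !csum_scal.
         f_equal; apply csum_ext; intros; ring. }
    rewrite csum_plus, Cmult_plus_distr_l, <- !csum_scal. f_equal.
    - rewrite (csum_triangle (fun n r => theta_term a b (Z.of_nat r)
                       * (q ^ (n * n) * centred_weight q n r))).
      apply csum_ext. intros r _. unfold W.
      rewrite csum_scal.
      rewrite (csum_ext _ (fun k => q ^ (r * r) * durfee_term q (2 * r) k))
        by (intros k _; apply Hw).
      rewrite csum_scal. field. exact Hnz.
    - rewrite csum_first. simpl (csum _ 0). rewrite Cplus_0_l.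
      rewrite (csum_triangle (fun n r => theta_term a b (- Z.of_nat (S r))
                       * (q ^ (S n * S n) * centred_weight q (S n) (S r)))).
      apply csum_ext. intros r _. unfold W.
      rewrite csum_scal.
      rewrite (csum_ext _ (fun k => q ^ (S r * S r) * durfee_term q (2 * S r) k)).
      2: { intros k _. rewrite <- Nat.add_succ_r. apply Hw. }
      rewrite csum_scal. change (S N - S r)%nat with (N - r)%nat.
      field. exact Hnz. }
  apply (tends_ext_ge 1 (fun n => csum T (S (pred n)))).
  { intros [|n] Hn; [lia | reflexivity]. }
  apply (tends_subseq pred (fun N => csum T (S N))); [|exact Hshift].
  intros M. exists (S M). intros; lia.
Qed.

(** * Two specializations *)

(** The pentagonal number theorem. For a = -1, b = -q the factor (1; q)_n kills
    all terms of [bailey_theta_sum] but the first, and the sum is 1. *)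
Lemma theta_neg_qpoch_inf (q : C) :
  (Cmod q < 1)%R -> theta_neg q = qpoch_inf q q.
Proof.
  intros Hq. destruct (inv_qpoch_tends q Hq) as [Hnz _].
  assert (Eq : - (1) * - q = q) by ring.
  assert (H := bailey_theta_sum (- (1)) (- q)). rewrite Eq in H. specialize (H Hq).
  replace (- (1) * q) with (- q) in H by ring.
  replace (- q * q) with (- q ^ 2) in H by (simpl; ring).
  assert (E : theta (- q) (- q ^ 2) / qpoch_inf q q = 1).
  { apply (tends_unique _ _ _ H).
    apply (tends_ext_ge 1 (fun _ => 1)); [|apply tends_const].
    intros [|n] Hn; [lia|]. rewrite csum_first.
    rewrite (csum_ext _ (fun _ => 0)).
    - rewrite csum_zero. simpl. field.
    - intros k _. rewrite qpoch_first. field. apply qpoch_neq_0, Hq. }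
  unfold theta_neg.
  replace (theta (- q) (- q ^ 2))
    with (theta (- q) (- q ^ 2) / qpoch_inf q q * qpoch_inf q q) by (field; exact Hnz).
  rewrite E. ring.
Qed.

(** With T_j = j(j+1)/2, the series f(1, x) takes each value x^(T_j) twice. In
    f(x, x^3) the index n >= 1 gives T_(2n-1), the index -n gives T_(2n), and
    the index 0 gives T_0, so that every value occurs once. *)
Lemma triangular_theta (x : C) :
  (Cmod x < 1)%R -> theta 1 x = 2 * theta x (x ^ 3).
Proof.
  intros Hx.
  assert (H3 : (Cmod (x * x ^ 3) < 1)%R).
  { rewrite <- Cpow_S. apply Cmod_pow_lt_1; [exact Hx | lia]. }
  destruct (theta_tends x (x ^ 3) H3) as [HA HB].
  destruct (theta_tends 1 x ltac:(rewrite Cmult_1_l; exact Hx)) as [Hpos Hneg].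
  destruct (theta_tends x 1 ltac:(rewrite Cmult_1_r; exact Hx)) as [HP _].
  set (P := CSeries (fun n => theta_term x 1 (Z.of_nat n))) in HP.
  set (p := fun n => theta_term x 1 (Z.of_nat n)) in HP.
  assert (Hp : forall n, p n = x ^ Z.to_nat (tri (Z.of_nat n))).
  { intros n. unfold p. rewrite theta_term_tri, Cpow_1_l. ring. }
  (* The 2n + 1 first triangular numbers come from the indices -n, ..., n. *)
  assert (EP : theta x (x ^ 3) = P).
  { apply (tends_unique (fun n => csum p (2 * n + 1))).
    - unfold theta.
      apply (tends_ext (fun n =>
        csum (fun r => theta_term x (x ^ 3) (Z.of_nat r)) (S n)
        + csum (fun r => theta_term x (x ^ 3) (- Z.of_nat (S r))) n)).
      + intros n. induction n as [|n IH].
        * simpl. unfold p. rewrite !theta_term_0. ring.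
        * replace (2 * S n + 1)%nat with (S (S (2 * n + 1))) by lia.
          change (csum p (S (S (2 * n + 1))))
            with (csum p (2 * n + 1) + p (2 * n + 1)%nat + p (S (2 * n + 1))).
          rewrite <- IH.
          change (csum ?f (S (S n))) with (csum f (S n) + f (S n)).
          change (csum (fun r => theta_term x (x ^ 3) (- Z.of_nat (S r))) (S n))
            with (csum (fun r => theta_term x (x ^ 3) (- Z.of_nat (S r))) n
                  + theta_term x (x ^ 3) (- Z.of_nat (S n))).
          cbv beta.
          replace (p (2 * n + 1)%nat) with (theta_term x (x ^ 3) (Z.of_nat (S n))).
          replace (p (S (2 * n + 1))) with (theta_term x (x ^ 3) (- Z.of_nat (S n))).
          { ring. }
          -- rewrite Hp, theta_term_opp, theta_term_tri, <- Cpow_mult_r, <- Cpow_add_r.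
             f_equal. destruct (tri_ge (Z.of_nat (S n))).
             assert (T1 := tri_double (Z.of_nat (S n))).
             assert (T2 := tri_double (Z.of_nat (S (2 * n + 1)))).
             apply Nat2Z.inj.
             rewrite Nat2Z.inj_add, Nat2Z.inj_mul, !Z2Nat.id by (try apply tri_ge; lia).
             lia.
          -- rewrite Hp, theta_term_tri, <- Cpow_mult_r, <- Cpow_add_r.
             f_equal. destruct (tri_ge (Z.of_nat (S n))).
             assert (T1 := tri_double (Z.of_nat (S n))).
             assert (T2 := tri_double (Z.of_nat (2 * n + 1))).
             apply Nat2Z.inj.
             rewrite Nat2Z.inj_add, Nat2Z.inj_mul, !Z2Nat.id by (try apply tri_ge; lia).
             lia.
      + apply tends_plus; [|exact HB].
        apply (tends_subseq S _ _ ltac:(intros M; exists M; intros; lia) HA).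
    - apply (tends_subseq (fun n => 2 * n + 1)%nat _ _
               ltac:(intros M; exists M; intros; lia) HP). }
  rewrite EP. unfold theta.
  (* In f(1, x) the indices 0 and 1 both give x^0; P - 1 below lacks T_0. *)
  assert (E1 : CSeries (fun n => theta_term 1 x (Z.of_nat n)) = 1 + P).
  { apply CSeries_eq.
    apply (tends_ext_ge 1 (fun n => 1 + csum p (pred n))).
    - intros [|n] Hn; [lia|]. rewrite csum_first. change (Z.of_nat 0) with 0%Z.
      rewrite theta_term_0. f_equal. apply csum_ext. intros k _.
      rewrite Hp, theta_term_tri, Cpow_1_l, Cmult_1_l.
      rewrite Nat2Z.inj_succ, <- Z.add_1_r, tri_succ. do 2 f_equal. ring.
    - apply tends_plus; [apply tends_const|].
      apply (tends_subseq pred _ _ ltac:(intros M; exists (S M); intros; lia) HP). }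
  assert (E2 : CSeries (fun n => theta_term 1 x (- Z.of_nat (S n))) = P - 1).
  { apply CSeries_eq.
    apply (tends_ext (fun n => csum p (S n) + - (1))).
    - intros n. rewrite csum_first.
      replace (p O) with (RtoC 1) by (unfold p; simpl; rewrite theta_term_0; reflexivity).
      rewrite (csum_ext (fun k => p (S k)) (fun n => theta_term 1 x (- Z.of_nat (S n)))).
      + ring.
      + intros k _. rewrite theta_term_opp. reflexivity.
    - apply tends_plus; [|apply tends_const].
      apply (tends_subseq S _ _ ltac:(intros M; exists M; intros; lia) HP). }
  rewrite E1, E2. ring.
Qed.

(** The shift n = m + 2 comes from (-1/q; q)_n, whose first two factors
    1 + 1/q and 1 + 1 precede (-q; q)_(n-2). *)
Lemma slater_term (q : C) (m : nat) :
  q <> 0 -> (Cmod q < 1)%R ->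
  q ^ ((m + 2) * (m + 2))
    * (qpoch (- / q) q (m + 2) * qpoch (- q ^ 2) q (m + 2)
       / qpoch q q (2 * (m + 2)))
  = 2 * (q ^ (S m * (S m + 2)) * qpoch (- q) q (S m - 1) * qpoch (- q) q (S m + 2)
         / qpoch q q (2 * S m + 2)).
Proof.
  intros Hq0 Hq.
  assert (H1 : 1 + q <> 0).
  { replace (1 + q) with (1 - - q) by ring.
    apply one_minus_neq_0. rewrite Cmod_opp. exact Hq. }
  assert (EX : qpoch (- / q) q (m + 2) = (1 + / q) * (2 * qpoch (- q) q m)).
  { replace (m + 2)%nat with (S (S m)) by lia. rewrite !qpoch_first.
    replace (- / q * q * q) with (- q) by (field; exact Hq0). field. exact Hq0. }
  assert (EY : qpoch (- q) q (S m + 2) = (1 + q) * qpoch (- q ^ 2) q (m + 2)).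
  { replace (S m + 2)%nat with (S (m + 2)) by lia. rewrite qpoch_first.
    replace (- q * q) with (- q ^ 2) by (simpl; ring). ring. }
  replace (S m - 1)%nat with m by lia.
  replace (2 * S m + 2)%nat with (2 * (m + 2))%nat by lia.
  replace ((m + 2) * (m + 2))%nat with (S (S m * (S m + 2))) by lia.
  rewrite EX, EY, Cpow_S. field. split; [apply qpoch_neq_0, Hq | exact Hq0].
Qed.

(** [bailey_theta_sum] for a = 1/q, b = q^2 evaluates twice the series of the
    theorem together with two initial terms, and those two add up to twice the
    rational function subtracted here. *)
Lemma slater_sum (q : C) :
  q <> 0 -> (Cmod q < 1)%R ->
  tends (csum (fun m => q ^ (S m * (S m + 2)) * qpoch (- q) q (S m - 1)
                        * qpoch (- q) q (S m + 2) / qpoch q q (2 * S m + 2)))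
    (theta (q ^ 3) (q ^ 9) / theta_neg q
     - (1 + q ^ 3) / ((1 - q) * (1 - q ^ 2))).
Proof.
  intros Hq0 Hq.
  assert (Eq : / q * q ^ 2 = q) by (simpl; field; exact Hq0).
  assert (H := bailey_theta_sum (/ q) (q ^ 2)). rewrite Eq in H. specialize (H Hq).
  replace (/ q * q) with (RtoC 1) in H by (field; exact Hq0).
  replace (q ^ 2 * q) with (q ^ 3) in H by (simpl; ring).
  rewrite triangular_theta in H by (apply Cmod_pow_lt_1; [exact Hq | lia]).
  rewrite <- Cpow_mult_r in H. change (3 * 3)%nat with 9%nat in H.
  rewrite <- theta_neg_qpoch_inf in H by exact Hq.
  assert (HD := fun n => one_minus_pow_neq_0 q n Hq).
  assert (HD0 := HD 0%nat). assert (HD1 := HD 1%nat). simpl in HD0, HD1.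
  rewrite !Cmult_1_r in HD0, HD1.
  set (T := fun n => _) in H.
  set (t := fun m : nat => _).
  assert (ET : forall n, csum T (n + 2)
            = 2 * ((1 + q ^ 3) / ((1 - q) * (1 - q ^ 2)) + csum t n)).
  { intros n. rewrite Nat.add_comm. induction n as [|n IH].
    - unfold T. simpl. field. auto.
    - rewrite Nat.add_succ_r.
      change (csum T (S (2 + n))) with (csum T (2 + n) + T (2 + n)%nat).
      change (csum t (S n)) with (csum t n + t n).
      rewrite IH, (Nat.add_comm 2 n).
      unfold T. rewrite slater_term by assumption. fold (t n). ring. }
  apply (tends_ext (fun n => / 2 * csum T (n + 2)
                     + - ((1 + q ^ 3) / ((1 - q) * (1 - q ^ 2))))).
  { intros n. rewrite ET.
    set (e := (1 + q ^ 3) / ((1 - q) * (1 - q ^ 2))). field. }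
  unfold Cminus at 1. apply tends_plus; [|apply tends_const].
  replace (theta (q ^ 3) (q ^ 9) / theta_neg q)
    with (/ 2 * (2 * theta (q ^ 3) (q ^ 9) / theta_neg q)).
  2: { unfold Cdiv. rewrite !Cmult_assoc, Cinv_l, Cmult_1_l; [reflexivity|].
       intros E. apply RtoC_inj in E. lra. }
  apply tends_scal.
  apply (tends_subseq (fun n => n + 2)%nat); [|exact H].
  intros M. exists M. intros; lia.
Qed.

(** * The identity *)

Theorem mainTheorem8 (q : C) (hq : (Cmod q < 1)%R) :
  let t := fun n : nat =>
    q ^ (n * (n + 2)) * qpoch (- q) q (n - 1) * qpoch (- q) q (n + 2)
      / qpoch q q (2 * n + 2) in
  ex_series (K := C_AbsRing) (V := C_NormedModule) (fun m : nat => t (S m))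
  /\ (1 + q ^ 3) / ((1 - q) * (1 - q ^ 2)) + CSeries (fun m : nat => t (S m))
     = theta (q ^ 3) (q ^ 9) / theta_neg q
  /\ theta (q ^ 3) (q ^ 9) / theta_neg q
     = qpoch_inf_list [- q ^ 3; - q ^ 9; q ^ 12] (q ^ 12) / qpoch_inf q q.
Proof.
  intros t.
  assert (Hab : q ^ 3 * q ^ 9 = q ^ 12) by (rewrite <- Cpow_add_r; reflexivity).
  assert (Hprod : theta (q ^ 3) (q ^ 9)
            = qpoch_inf_list [- q ^ 3; - q ^ 9; q ^ 12] (q ^ 12)).
  { rewrite jacobi_triple_product, Hab.
  - cbn [qpoch_inf_list fold_right]. ring.
    - rewrite Hab. apply Cmod_pow_lt_1; [exact hq | lia]. }
  assert (Ht : tends (csum (fun m => t (S m)))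
            (theta (q ^ 3) (q ^ 9) / theta_neg q
             - (1 + q ^ 3) / ((1 - q) * (1 - q ^ 2)))).
  (* For q = 0 the value a = 1/q is not available, but every term of the series
     vanishes. *)
  { destruct (Ceq_dec q 0) as [-> | Hq0]; [|exact (slater_sum q Hq0 hq)].
    assert (E00 : qpoch_inf 0 0 = 1).
    { apply qpoch_inf_eq. apply (tends_ext (fun _ => 1)); [|apply tends_const].
      intros n. induction n as [|n IH]; simpl; [reflexivity|]. rewrite <- IH. ring. }
    rewrite Hprod, theta_neg_qpoch_inf by exact hq.
    replace (0 ^ 12) with (RtoC 0) by (simpl; ring).
    replace (- 0 ^ 3) with (RtoC 0) by (simpl; ring).
    replace (- 0 ^ 9) with (RtoC 0) by (simpl; ring).
    cbn [qpoch_inf_list fold_right]. rewrite E00.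
    replace (1 * (1 * (1 * 1)) / 1 - (1 + 0 ^ 3) / ((1 - 0) * (1 - 0 ^ 2)))
      with (RtoC 0) by (simpl; field; simpl; split; intros E; apply C1_nz; rewrite <- E; ring).
    apply (tends_ext (fun _ => 0)); [|apply tends_const].
    intros n. rewrite <- (csum_zero n). apply csum_ext. intros m _.
    unfold t. replace (S m * (S m + 2))%nat with (S (m * (m + 4) + 2)) by lia.
    rewrite Cpow_S. unfold Cdiv. ring. }
  split; [|split].
  - exists (theta (q ^ 3) (q ^ 9) / theta_neg q
            - (1 + q ^ 3) / ((1 - q) * (1 - q ^ 2))).
    apply is_series_tends, Ht.
  - rewrite (CSeries_eq _ _ Ht). ring.
  - rewrite Hprod, theta_neg_qpoch_inf by exact hq. reflexivity.
Qed.
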